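(* Let $P$ be a poset. The space $\mathrm{MF}(P)$ is homeomorphic to $\mathrm{MF}(R)$ for some countable poset $R$ if and only if $\mathrm{MF}(P)$ is second countable.
   Context: A poset is a set $P$ with a reflexive, antisymmetric, transitive relation $\preceq$. A filter on $P$ is a nonempty subset $F\subseteq P$ such that (1) for all $p,q\in F$ there is $r\in F$ with $r\preceq p$ and $r\preceq q$, and (2) if $p\in F$, $q\in P$ and $p\preceq q$ then $q\in F$. A filter is maximal if no strictly larger filter contains it. $\mathrm{MF}(P)$ is the set of maximal filters on $P$, with the topology having basis $\{N_p : p\in P\}$, where $N_p=\{F\in \mathrm{MF}(P) : p\in F\}$. *)

(* Defs.v *)
From HB Require Import structures.
From mathcomp Require Import all_boot all_order.
From mathcomp Require Import all_classical topology.

Set Implicit Arguments.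
Unset Strict Implicit.
Unset Printing Implicit Defensive.

Local Open Scope classical_set_scope.
Local Open Scope order_scope.

(* A poset is a [porderType]; under the classical axioms of [boolp], every type
   with a reflexive, antisymmetric and transitive relation can be equipped with
   such a structure.  The carrier may be empty. *)

Section MaximalFilters.
Context {d : Order.disp_t} {P : porderType d}.

Definition poset_filter (F : set P) : Prop :=
  [/\ F !=set0,
      forall p q, F p -> F q -> exists r, [/\ F r, r <= p & r <= q]
    & forall p q, F p -> p <= q -> F q].

Definition maximal_filter (F : set P) : Prop :=
  poset_filter F /\ ~ exists G : set P, poset_filter G /\ F `<` G.

End MaximalFilters.

Record MF {d : Order.disp_t} (P : porderType d) := MkMF {
  MF_set :> set P;
  MF_maximal : maximal_filter MF_set }.

HB.instance Definition _ d (P : porderType d) := gen_eqMixin (MF P).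
HB.instance Definition _ d (P : porderType d) := gen_choiceMixin (MF P).

Section MFTopology.
Context {d : Order.disp_t} {P : porderType d}.

Definition MFN (p : P) : set (MF P) := [set F : MF P | (F : set P) p].

Lemma MFN_cover : \bigcup_(U in range MFN) U = [set: MF P].
Proof.
rewrite predeqE => F; split=> // _.
have [[[p Fp] _ _] _] := MF_maximal F.
by exists (MFN p) => //; exists p.
Qed.

Lemma MFN_join (U V : set (MF P)) (F : MF P) :
  range MFN U -> range MFN V -> U F -> V F ->
  exists W, [/\ range MFN W, W F & W `<=` U `&` V].
Proof.
move=> [p _ <-] [q _ <-] Fp Fq.
have [[_ dirF _] _] := MF_maximal F.
have [r [Fr rp rq]] := dirF _ _ Fp Fq.
exists (MFN r); split=> // G Gr.
have [[_ _ upG] _] := MF_maximal G.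
by split; [exact: upG _ _ Gr rp | exact: upG _ _ Gr rq].
Qed.

(* The base is indexed by the sets [MFN p] themselves rather than by [p]:
   [isBaseTopological] wants a pointed index type, and [P] may be empty. *)
HB.instance Definition _ :=
  @isBaseTopological.Build (MF P) (set (MF P)) (range MFN) id MFN_cover MFN_join.

Lemma MF_openE :
  @open (MF P) = [set \bigcup_(p in D) MFN p | D in [set: set P]].
Proof.
rewrite predeqE => U; split.
- move=> [D sD <-]; exists [set p | D (MFN p)] => //.
  rewrite predeqE => F; split=> [[p Dp Fp]|[V DV VF]]; first by exists (MFN p).
  by have [p _ eV] := sD _ DV; exists p; rewrite /= eV.
- move=> [D _ <-]; exists [set MFN p | p in D].
    by move=> _ [p _ <-]; exists p.
  rewrite predeqE => F; split=> [[_ [p Dp <-] Fp]|[p Dp Fp]]; first by exists p.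
  by exists (MFN p) => //; exists p.
Qed.

Lemma MF_basis : basis (range (MFN : P -> set (MF P))).
Proof.
split=> [_ [p _ <-]|F].
  rewrite MF_openE; exists [set p] => //; exact: bigcup_set1.
move=> A; rewrite nbhsE => -[U [+ UF] sUA].
rewrite MF_openE => -[D _ eU]; move: UF sUA; rewrite -eU => -[p Dp Fp] sUA.
exists (MFN p); first by split=> //; exists p.
by move=> G Gp; apply: sUA; exists p.
Qed.

End MFTopology.

Definition homeomorphic (X Y : topologicalType) : Prop :=
  exists (f : X -> Y) (g : Y -> X),
    [/\ cancel f g, cancel g f, continuous f & continuous g].

(* Main.v *)
Require Import Defs.
From mathcomp Require Import all_boot all_order.
From mathcomp Require Import all_classical topology.

(** If [MF P] has a countable base [B], choose for all [U], [V] in [B] some [p]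
    with [U `<=` MFN p `<=` V], and close the countable set of these [p] under
    choosing, for [p], [q] in the set and [U] in [B], a common lower bound [r] of
    [p] and [q] with [U `<=` MFN r].  The resulting countable subposet [S]
    still gives a base of [MF P], and the trace on [S] of each maximal filter is
    again directed.  As no maximal filter is contained in another one, these
    two properties make [F |-> F `&` S] a homeomorphism onto [MF S]. *)

Import Order.TTheory.

Local Open Scope order_scope.
Local Open Scope classical_set_scope.

Section MaximalFilterTheory.
Context {d : Order.disp_t} {P : porderType d}.

Lemma MF_sub_eq (F G : MF P) : F `<=` G -> F = G.
Proof.
move=> FG; have eFG : (F : set P) = G.
  apply: contrapT => neFG; have [_] := MF_maximal F; apply.
  exists G; split; [exact: (MF_maximal G).1 | split=> // GF].
  by apply: neFG; exact/seteqP.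
move: F G eFG {FG} => [F Fm] [G Gm] /= eFG; subst G.
by congr MkMF; exact: Prop_irrelevance.
Qed.

Lemma poset_filter_extend (F : set P) :
  poset_filter F -> exists G : MF P, F `<=` G.
Proof.
move=> filtF.
(* [Zorn_bigcup] also asks for a bound of the empty chain; here that is [F]. *)
have [|A [filtA maxA]] := @Zorn_bigcup P (fun A => poset_filter (F `|` A)).
  move=> C filtC totC; have [F0 dirF upF] := filtF.
  (* Every point is located in one filter, either [F] or some [F] enlarged by a member of [C]. As
     [C] is a chain, two such filters are comparable, so directedness is inherited from the larger
     one. *)
  have cover p : (F `|` \bigcup_(X in C) X) p ->
      exists2 A, (A = F \/ exists2 X, C X & A = F `|` X) & A p.
    move=> [Fp|[X CX Xp]]; first by exists F => //; left.
    by exists (F `|` X); [right; exists X | right].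
  have subA A : (A = F \/ exists2 X, C X & A = F `|` X) ->
      poset_filter A /\ A `<=` F `|` \bigcup_(X in C) X.
    move=> [->|[X CX ->]]; first by split=> // p Fp; left.
    split; first exact: filtC.
    by move=> p [Fp|Xp]; [left | right; exists X].
  split.
  - by have [p Fp] := F0; exists p; left.
  - move=> p q /cover[A hA Ap] /cover[B hB Bq].
    suff [D [hD Dp Dq]] : exists D,
        [/\ D = F \/ (exists2 X, C X & D = F `|` X), D p & D q].
      have [[_ dirD _] sD] := subA _ hD.
      by have [r [Dr rp rq]] := dirD _ _ Dp Dq; exists r; split=> //; exact: sD.
    case: (hA) (hB) => [eA|[X CX eA]] [eB|[Y CY eB]]; subst A B.
    + by exists F; split=> //; left.
    + by exists (F `|` Y); split=> //; left.
    + by exists (F `|` X); split=> //; left.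
    + have [XY|YX] := totC _ _ CX CY.
        exists (F `|` Y); split=> //.
        by case: Ap => [Fp|/XY Yp]; [left|right].
      exists (F `|` X); split=> //.
      by case: Bq => [Fp|/YX Xp]; [left|right].
  - move=> p q /cover[A /subA[[_ _ upA] sA] Ap] pq.
    by apply: sA; exact: upA pq.
have maxFA : maximal_filter (F `|` A).
  split=> // -[G [filtG FAG]].
  have FG : F `<=` G by move=> p Fp; apply: FAG.1; left.
  (* [G] itself competes with [A]: it absorbs [F], and it is strictly larger than [A] because it is
     not contained in [F] joined with [A]. *)
  apply: (maxA G); last by rewrite (setUidr FG).
  split; first by move=> p Ap; apply: FAG.1; right.
  by move=> GA; apply: FAG.2 => p /GA Ap; right.
by exists (MkMF maxFA) => p Fp; left.
Qed.

Lemma open_MFN (p : P) : open (MFN p).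
Proof. by apply: (MF_basis.1); exists p. Qed.

Lemma MF_continuous (T : topologicalType) (f : T -> MF P) :
  (forall p, open (f @^-1` MFN p)) -> continuous f.
Proof.
move=> fN; apply/continuousP => A; rewrite MF_openE => -[D _ <-].
by rewrite preimage_bigcup; apply: bigcup_open => p _; exact: fN.
Qed.

Lemma basis_sub_open (T : topologicalType) (B : set (set T)) (A : set T) x :
  basis B -> open A -> A x -> exists U, [/\ B U, U x & U `<=` A].
Proof.
move=> [_ /(_ x) Bx] oA Ax.
by have [U [BU Ux] UA] := Bx A (open_nbhs_nbhs (conj oA Ax)); exists U.
Qed.

End MaximalFilterTheory.

Section DenseEmbedding.
Context {d d' : Order.disp_t} {P : porderType d} {R : porderType d'}.
Variable i : R -> P.
Hypothesis i_mono : {mono i : x y / x <= y}.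
Hypothesis i_base : forall (F : MF P) p, (F : set P) p ->
  exists2 r, (F : set P) (i r) & MFN (i r) `<=` MFN p.
(** [i_base] compares only neighbourhoods, not elements, so lower bounds taken in [P] cannot be
    moved into [R] by it. *)
Hypothesis i_dir : forall (F : MF P) x y,
  (F : set P) (i x) -> (F : set P) (i y) ->
  exists z, [/\ (F : set P) (i z), z <= x & z <= y].

Lemma trace_sub_eq (F G : MF P) : i @^-1` F `<=` i @^-1` G -> F = G.
Proof.
move=> FG; apply: MF_sub_eq => p /i_base[r Fr]; apply.
exact: FG.
Qed.

Lemma trace_filter (F : MF P) : poset_filter (i @^-1` F).
Proof.
have [[[p Fp] _ upF] _] := MF_maximal F; split.
- by have [r Fr _] := i_base _ _ Fp; exists r.
- by move=> x y; exact: i_dir.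
- by move=> x y Fx xy; apply: upF Fx _; rewrite i_mono.
Qed.

(** The upward closure in [P] of the image of [G] is a filter, and so extends to a maximal one. *)
Lemma filter_sub_trace (G : set R) :
  poset_filter G -> exists F : MF P, G `<=` i @^-1` F.
Proof.
move=> [[r Gr] dirG _].
have [|F GF] := @poset_filter_extend _ P [set p | exists2 x, G x & i x <= p].
  split; first by exists (i r), r.
  - move=> p q [x Gx xp] [y Gy yq]; have [z [Gz zx zy]] := dirG _ _ Gx Gy.
    exists (i z); split; first by exists z.
      by rewrite (le_trans _ xp)// i_mono.
    by rewrite (le_trans _ yq)// i_mono.
  - by move=> p q [x Gx xp] pq; exists x => //; exact: le_trans pq.
by exists F => x Gx; apply: GF; exists x.
Qed.

(** A larger filter on [R] lies in the trace of some [F']; the traces of [F] and [F'] are then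
    nested, which forces [F = F']. *)
Lemma trace_maximal (F : MF P) : maximal_filter (i @^-1` F).
Proof.
split; first exact: trace_filter.
move=> [G [filtG [FG GF]]]; have [F' GF'] := filter_sub_trace _ filtG.
have eF : F = F' by apply: trace_sub_eq; exact: subset_trans FG GF'.
by apply: GF; rewrite eF.
Qed.

Lemma trace_homeomorphic : homeomorphic (MF P) (MF R).
Proof.
pose f (F : MF P) := MkMF (trace_maximal F).
have f_inj : injective f.
  by move=> F G fFG; apply: trace_sub_eq; rewrite -[_ @^-1` F]/(f F : set R) fFG.
(* Surjectivity: [G] lies in the trace of some [F], and maximality of [G] makes this an equality. *)
have /choice[g gK] : forall G : MF R, exists F, f F = G.
  move=> G; have [F GF] := filter_sub_trace _ (MF_maximal G).1.
  by exists F; apply/esym; exact: MF_sub_eq.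
exists f, g; split=> //.
- by move=> F; apply: f_inj; rewrite gK.
- by apply: MF_continuous => r; exact: (open_MFN (i r)).
- apply: MF_continuous => p.
  suff -> : g @^-1` MFN p = \bigcup_(r in [set r | MFN (i r) `<=` MFN p]) MFN r.
    by apply: bigcup_open => r _; exact: open_MFN.
  have gE (G : MF R) r : (G : set R) r = (g G : set P) (i r) by rewrite -{1}(gK G).
  apply/seteqP; split=> [G /= Gp|G [r /= rp]].
    by have [r Gr rp] := i_base _ _ Gp; exists r; rewrite /MFN/= ?gE.
  by rewrite /MFN/= gE => Gr; exact: rp.
Qed.

End DenseEmbedding.

(** Choosing a subset with at most one point, rather than a point, avoids a default element when [A]
    or [T] is empty. *)
Lemma countable_selection (T : Type) (A : set T) :
  exists C : set T, [/\ countable C, C `<=` A & A !=set0 -> C !=set0].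
Proof.
have [[x Ax]|A0] := pselect (A !=set0); last by exists set0; split.
exists [set x]; split=> [|_ ->|_] //; last by exists x.
Qed.

Lemma countable_dense_subset (d : Order.disp_t) (P : porderType d) :
  @second_countable (MF P) ->
  exists S : set P, [/\ countable S,
    forall (F : MF P) p, (F : set P) p ->
      exists r, [/\ S r, (F : set P) r & MFN r `<=` MFN p]
  & forall (F : MF P) p q, S p -> S q -> (F : set P) p -> (F : set P) q ->
      exists r, [/\ S r, (F : set P) r, r <= p & r <= q]].
Proof.
move=> [B cB basisB]; have /choice[c cP] := @countable_selection P.
pose base : set P :=
  \bigcup_(U in B) \bigcup_(V in B) c [set p | U `<=` MFN p /\ MFN p `<=` V].
(* One lower bound per pair would not do, since it may miss some maximal filter containing [p] and
   [q]. Indexing by [U] puts the chosen [r] in every filter belonging to [U]. *)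
pose meets (E : set P) : set P := \bigcup_(p in E) \bigcup_(q in E)
  \bigcup_(U in B) c [set r | [/\ U `<=` MFN r, r <= p & r <= q]].
pose E n := iter n (fun E => E `|` meets E) base.
have Emono m n : (m <= n)%N -> E m `<=` E n.
  move=> /subnK <-; elim: (n - m)%N => [|k IH] p Ep //.
  by rewrite addSn; left; exact: IH.
have cE n : countable (E n).
  elim: n => [|n IH].
    apply: bigcup_countable => // U _; apply: bigcup_countable => // V _.
    by have [] := cP [set p | U `<=` MFN p /\ MFN p `<=` V].
  (* The binary union becomes a sequence with terms [E n], [meets (E n)] and then empty sets; only
     the second term needs work. *)
  rewrite /E iterS -/(E n) -bigcup2E; apply: bigcup_countable => // k _.
  case: k => [|[|k]] //=; apply: bigcup_countable => // p _.
  apply: bigcup_countable => // q _; apply: bigcup_countable => // U _.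
  by have [] := cP [set r | [/\ U `<=` MFN r, r <= p & r <= q]].
exists (\bigcup_n E n); split.
- by apply: bigcup_countable => // n _; exact: cE.
- move=> F p Fp.
  have [V [BV VF Vp]] := @basis_sub_open _ _ _ F basisB (open_MFN p) Fp.
  have [_ [[q _ <-] Fq] qV] := MF_basis.2 F V (open_nbhs_nbhs (conj (basisB.1 _ BV) VF)).
  have [U [BU UF Uq]] := @basis_sub_open _ _ _ F basisB (open_MFN q) Fq.
  have [_ cs cn] := cP [set p | U `<=` MFN p /\ MFN p `<=` V].
  (* [q] only shows that the selection for [U] and [V] is nonempty; the selected [r] may differ from
     it. *)
  have [|r cr] := cn; first by exists q.
  have [Ur rV] := cs _ cr; exists r; split.
  + by exists 0%N => //; exists U => //; exists V.
  + exact: Ur UF.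
  + exact: subset_trans Vp.
- move=> F p q [m _ Ep] [n _ Eq] Fp Fq.
  have [[_ dirF _] _] := MF_maximal F; have [s [Fs sp sq]] := dirF _ _ Fp Fq.
  have [U [BU UF Us]] := @basis_sub_open _ _ _ F basisB (open_MFN s) Fs.
  have [_ cs cn] := cP [set r | [/\ U `<=` MFN r, r <= p & r <= q]].
  have [|r cr] := cn; first by exists s.
  have [Ur rp rq] := cs _ cr; exists r; split=> //; last exact: Ur UF.
  (* Both [p] and [q] are present at stage [maxn m n], so [r] is added at the next one. *)
  exists (maxn m n).+1 => //; right.
  exists p; first exact: Emono (leq_maxl m n) _ Ep.
  exists q; first exact: Emono (leq_maxr m n) _ Eq.
  by exists U.
Qed.

Lemma countable_second_countable (d : Order.disp_t) (P : porderType d) :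
  countable [set: P] -> @second_countable (MF P).
Proof.
move=> cP; exists (range (@MFN _ P)); last exact: MF_basis.
exact: sub_countable (card_image_le _ _) cP.
Qed.

Lemma homeomorphic_second_countable (X Y : topologicalType) :
  homeomorphic X Y -> @second_countable Y -> @second_countable X.
Proof.
move=> [f [g [fK gK cf cg]]] [B cB basisB].
exists [set f @^-1` U | U in B].
  exact: sub_countable (card_image_le _ _) cB.
split=> [_ [U BU <-]|x A]; first exact: (continuousP f).1 cf _ (basisB.1 _ BU).
rewrite nbhsE => -[V [oV Vx] VA].
have [||U [BU Uf UV]] := @basis_sub_open _ _ (g @^-1` V) (f x) basisB.
- exact: (continuousP g).1 cg _ oV.
- by rewrite /= fK.
exists (f @^-1` U); first by split=> //; exists U.
by move=> y /UV /=; rewrite fK => /VA.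
Qed.

Theorem corollary3p3 (d : Order.disp_t) (P : porderType d) :
  (exists (d' : Order.disp_t) (R : porderType d'),
      countable [set: R] /\ homeomorphic (MF P) (MF R))
  <-> @second_countable (MF P).
Proof.
split=> [[d' [R [cR PR]]]|].
  by apply: homeomorphic_second_countable PR _; exact: countable_second_countable.
move=> /countable_dense_subset[S [cS baseS dirS]].
(* [sub_type] carries the order induced from [P], so the monotonicity of [val] is immediate. *)
exists d, (sub_type {x : P | x \in S}); split.
  by rewrite (eq_countable (card_setT S)).
apply: (@trace_homeomorphic _ _ _ _ (val : sub_type {x : P | x \in S} -> P)).
- by [].
- move=> F p /baseS[r [Sr Fr rp]].
  by exists (Sub r (mem_set Sr) : {x : P | x \in S}).
- move=> F x y Fx Fy.
  have [r [Sr Fr rx ry]] := dirS F _ _ (set_valP x) (set_valP y) Fx Fy.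
  by exists (Sub r (mem_set Sr) : {x : P | x \in S}).
Qed.
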